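(* Let $F$ be the Pareto distribution with tail index $1$, i.e. $1-F(x)=1/x$ for $x\ge 1$. Let $w_1,\dots,w_d\ge 0$ with $\sum_{i=1}^d w_i=1$ and let $T_w(x)=\sum_{i=1}^d w_i x_i$. Then the $(F,T_w)$-combination test is universally calibrated: for every random vector $(P_i)_{i=1}^d$ with Uniform$(0,1)$ marginals such that $X=(X_i)_{i=1}^d$, $X_i:=F^{-1}(1-P_i)$, is multivariate regularly varying, $$\lim_{t\to+\infty}\frac{\Pr\{T_w(X)>t\}}{\Pr(X_1>t)}=1.$$
   Context: For a distribution function $F$, $F^{-1}(p)=\inf\{x:F(x)\ge p\}$. Multivariate regular variation: a random vector $X$ in $\mathbb{R}^d$ is multivariate regularly varying if there exist a positive function $b(t)\to\infty$ and a non-zero Borel measure $\mu$ on $\mathbb{R}^d\setminus\{0\}$, finite on Borel sets bounded away from $0$, such that $b(t)\Pr(X\in tA)\to\mu(A)$ as $t\to\infty$ for all Borel sets $A\subset\mathbb{R}^d\setminus\{0\}$ that are bounded away from $0$ and satisfy $\mu(\partial A)=0$. *)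

(* Defs.v *)
(* MathComp-Analysis; the reals are an arbitrary [R : realType]. *)
From HB Require Import structures.
From mathcomp Require Export all_boot all_order all_algebra.
From mathcomp Require Export all_classical all_reals all_analysis.
Set Implicit Arguments.
Unset Strict Implicit.
Unset Printing Implicit Defensive.
Import Order.TTheory GRing.Theory Num.Theory.
Import numFieldTopology.Exports numFieldNormedType.Exports.

Local Open Scope classical_set_scope.
Local Open Scope ring_scope.

(* [inf] is the real infimum, which is 0 on sets that are empty or unbounded
   below.  This only matters for [p] outside the range where the generalized
   inverse is finite (for the Pareto law below: [p] outside ]0, 1[). *)
Definition quantile (R : realType) (F : R -> R) (p : R) : R :=
  inf [set x | p <= F x].

Definition pareto1_cdf (R : realType) (x : R) : R :=
  if 1 <= x then 1 - x^-1 else 0.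

Definition weighted_sum (R : realType) (d : nat) (w : 'I_d -> R)
    (x : 'rV[R]_d) : R :=
  \sum_(i < d) w i * x ord0 i.

Definition borel_rV (R : realType) (d : nat) :=
  g_sigma_algebraType (@open 'rV[R]_d).

Definition boundary (T : topologicalType) (A : set T) : set T :=
  closure A `\` interior A.

Definition bounded_away_from0 (R : realType) (d : nat) (A : set 'rV[R]_d)
    : Prop :=
  exists2 e : R, 0 < e & forall x, A x -> e <= `|x|.

(* A Borel measure on R^d \ {0} is represented by its extension to R^d that
   gives no mass to the origin.  For a set bounded away from 0, the boundaries
   in R^d \ {0} and in R^d coincide. *)
Definition multivariate_regularly_varying (R : realType)
    (disp : measure_display) (Omega : measurableType disp)
    (Pr : probability Omega R) (d : nat) (X : Omega -> 'rV[R]_d) : Prop :=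
  exists (b : R -> R) (mu : {measure set (borel_rV R d) -> \bar R}),
    [/\ (forall t, 0 < t -> 0 < b t) /\ b t @[t --> +oo] --> +oo,
        mu [set (0 : 'rV[R]_d)] = 0%E,
        exists2 A : set (borel_rV R d), measurable A & mu A != 0%E,
        forall A : set (borel_rV R d), measurable A ->
          bounded_away_from0 A -> (mu A < +oo)%E
      & forall A : set (borel_rV R d), measurable A ->
          bounded_away_from0 A ->
          mu (boundary (A : set 'rV[R]_d)) = 0%E ->
          ((b t)%:E * Pr (X @^-1` [set t *: x | x in (A : set 'rV[R]_d)]))%E
            @[t --> +oo] --> mu A].

(* X_i = F^{-1}(1 - P_i) *)
Definition transformed_vector (R : realType) (F : R -> R) (T : Type) (d : nat)
    (P : 'I_d -> T -> R) (omega : T) : 'rV[R]_d :=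
  \row_(i < d) quantile F (1 - P i omega).

Definition uniform01 (R : realType) (disp : measure_display)
    (Omega : measurableType disp) (Pr : probability Omega R)
    (U : {RV Pr >-> R}) : Prop :=
  forall A : set R, measurable A ->
    distribution Pr U A = uniform_prob (@ltr01 R) A.

(* The (F, T)-combination test is universally calibrated.  The dimension is
   [d.+1], so that the first coordinate X_1 exists (its index is [ord0]). *)
Definition universally_calibrated (R : realType) (d : nat) (F : R -> R)
    (T : 'rV[R]_d.+1 -> R) : Prop :=
  forall (disp : measure_display) (Omega : measurableType disp)
    (Pr : probability Omega R) (P : 'I_d.+1 -> {RV Pr >-> R}),
  (forall i, uniform01 (P i)) ->
  let X := transformed_vector F (fun i => P i : Omega -> R) in
  multivariate_regularly_varying Pr X ->
  fine (Pr [set omega | t < T (X omega)])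
    / fine (Pr [set omega | t < X omega ord0 ord0])
    @[t --> +oo] --> (1 : R).

(* Main.v *)
Require Import Defs.
From mathcomp Require Import measurable_realfun ring lra.
Set Implicit Arguments.
Unset Strict Implicit.
Unset Printing Implicit Defensive.
Import Order.TTheory GRing.Theory Num.Theory.
Import numFieldTopology.Exports numFieldNormedType.Exports.
Local Open Scope classical_set_scope.
Local Open Scope ring_scope.

(* The marginals are standard Pareto, so testing the convergence on half-spaces
   x_i > s gives b(t)/t -> c > 0 and mu{x_i > s} = c/s for every i. Dividing the
   defining limit by b(t)/t shows that mu is homogeneous of degree -1 on
   continuity sets, so mu{T_w > s} = K/s for some K, and t Pr(T_w(X) > t) tends
   to K/c. To see that K = c, integrate over D = {1 < T_w <= l}: homogeneity,
   applied to a geometric partition of the values of x_i, moves the truncation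
   from T_w to x_i and shows, when w_i > 0, that the integral of x_i over D equals
   mu{1 < x_i <= l} = c(1 - 1/l) up to a factor l. As the weights sum to 1, the
   integral of T_w over D lies within the same bounds; it is also within a
   factor l of mu(D) = K(1 - 1/l). Let l decrease to 1. *)

(** * Fibers charged by a finite measure *)

(** Distinct fibers are disjoint inside a set of finite mass, so only finitely many have mass above
    [n.+1%:R^-1]; the charged fibers are the union of these finite families over [n]. *)
Lemma countable_atoms (d : measure_display) (T : measurableType d)
    (R : realType) (mu : {measure set T -> \bar R}) (D : set T) (f : T -> R) :
  measurable D -> (mu D < +oo)%E -> measurable_fun D f ->
  countable [set s | mu (D `&` f @^-1` [set s]) != 0%E].
Proof.
move=> mD finD mf.
have mA s : measurable (D `&` f @^-1` [set s]) by exact: mf.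
rewrite [X in countable X](_ : _ = \bigcup_n
    [set s | (n.+1%:R^-1%:E < mu (D `&` f @^-1` [set s]))%E]); last first.
  apply/seteqP; split => [s /= s0|s [k _] /= ks]; last first.
    by rewrite gt_eqF// (lt_trans _ ks)// lte_fin invr_gt0.
  have fs : mu (D `&` f @^-1` [set s]) \is a fin_num.
    rewrite ge0_fin_numE//; apply: le_lt_trans finD.
    by apply: le_measure; rewrite ?inE//; exact: subIsetl.
  have : 0 < fine (mu (D `&` f @^-1` [set s])).
    by rewrite fine_gt0// lt0e s0 measure_ge0 -ge0_fin_numE.
  move/ltr_add_invr => [k]; rewrite add0r => ks.
  by exists k => //=; rewrite -(fineK fs) lte_fin.
apply: bigcup_countable => // n _; apply: finite_set_countable.
(* Otherwise an injective sequence [q] of such values exists, and for large [N] already [N] of these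
   fibers outweigh [D]. *)
apply: contrapT => /infiniteP/pcard_leP/injfunPex[/= q q_fun q_inj].
have : (mu (\bigcup_k (D `&` f @^-1` [set q k])) <= mu D)%E.
  apply: le_measure; rewrite ?inE//; first exact: bigcup_measurable.
  by move=> x [k _ []].
have finD' : mu D \is a fin_num by rewrite ge0_fin_numE.
rewrite measure_bigcup//; last first.
  rewrite (trivIset_comp (fun r => D `&` f @^-1` [set r]))//.
  by move=> i j _ _ [x [[_ <-] [_ <-]]].
rewrite leNgt => /negP; apply.
have [N hN] : exists N, fine (mu D) < N%:R * n.+1%:R^-1.
  exists (Num.trunc (fine (mu D) * n.+1%:R)).+1.
  by rewrite ltr_pdivlMr// truncnS_gt.
rewrite (@eq_eseriesl _ _ predT); last by move=> i; rewrite in_setT.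
apply: lt_le_trans (nneseries_lim_ge N _); last by [].
rewrite -(fineK finD'); apply: (@lt_le_trans _ _ (N%:R * n.+1%:R^-1)%:E).
  by rewrite lte_fin.
rewrite mulr_natl -[N in (_ *+ N)%:E]subn0 -sumr_const_nat -sumEFin.
by apply: lee_sum => k _; apply: ltW; exact: q_fun.
Qed.

(* The fibers of positive measure are countably many, hence Lebesgue null. *)
Lemma null_fiber_in_itv (d : measure_display) (T : measurableType d)
    (R : realType) (mu : {measure set T -> \bar R}) (D : set T) (f : T -> R)
    (a b : R) :
  measurable D -> (mu D < +oo)%E -> measurable_fun D f -> a < b ->
  exists2 s, a < s < b & mu (D `&` f @^-1` [set s]) = 0%E.
Proof.
move=> mD finD mf ab; apply: contrapT => noex.
have: countable `]a, b[%classic.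
  apply: sub_countable (countable_atoms mD finD mf).
  apply: subset_card_le => s /=; rewrite in_itv/= => sab.
  by apply/eqP => ms; apply: noex; exists s.
move/countable_lebesgue_measure0; rewrite lebesgue_measure_itv/= lte_fin ab.
by move/eqP; rewrite -EFinB eqe subr_eq0 gt_eqF.
Qed.

(** * Boundaries of sets cut out by continuous functions *)

Section boundary.
Context (T : topologicalType) (R : realType).
Implicit Types A B : set T.

Lemma boundaryI A B : boundary (A `&` B) `<=` boundary A `|` boundary B.
Proof.
move=> x [cAB nAB].
have cA : closure A x by apply: closureS cAB; exact: subIsetl.
have cB : closure B x by apply: closureS cAB; exact: subIsetr.
have [iA|] := pselect (interior A x); last by left.
have [iB|] := pselect (interior B x); last by right.
by exfalso; apply: nAB; exact: filterI.
Qed.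

Lemma boundary_gt (f : T -> R) (s : R) : continuous f ->
  boundary [set x | s < f x] `<=` [set x | f x = s].
Proof.
move=> cf x [cx nx] /=; apply/eqP; rewrite eq_le; apply/andP; split.
  rewrite leNgt; apply/negP => sx; apply: nx.
  by apply: open_nbhs_nbhs; split => //;
    apply: open_comp (@open_gt _ s) => ? _; exact: cf.
suff: (f @^-1` [set y | s <= y]) x by [].
have /closure_id -> : closed (f @^-1` [set y | s <= y]).
  by apply: closed_comp (@closed_ge _ s) => ? _; exact: cf.
by apply: closureS cx => y /=; exact: ltW.
Qed.

Lemma boundary_le (f : T -> R) (s : R) : continuous f ->
  boundary [set x | f x <= s] `<=` [set x | f x = s].
Proof.
move=> cf x [cx nx] /=; apply/eqP; rewrite eq_le; apply/andP; split.
  suff: (f @^-1` [set y | y <= s]) x by [].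
  have /closure_id -> : closed (f @^-1` [set y | y <= s]).
    by apply: closed_comp (@closed_le _ s) => ? _; exact: cf.
  exact: cx.
rewrite leNgt; apply/negP => sx; apply: nx.
apply: (@filterS _ (nbhs x) _ (f @^-1` [set y | y < s])).
  by move=> y /=; exact: ltW.
by apply: open_nbhs_nbhs; split => //;
  apply: open_comp (@open_lt _ s) => ? _; exact: cf.
Qed.

End boundary.

(** * Linear forms, half-spaces and dilations *)

Section linear_functional.
Context (R : realType) (n : nat).
Implicit Types (u : 'I_n -> R) (x : 'rV[R]_n) (s r : R) (A : set 'rV[R]_n).

Lemma weighted_sum_continuous u : continuous (weighted_sum u).
Proof.
apply: continuous_big => [|i _]; first exact: add_continuous.
move=> x; apply: continuousM; first exact: cst_continuous.
exact: coord_continuous.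
Qed.

Lemma weighted_sumZ u r x : weighted_sum u (r *: x) = r * weighted_sum u x.
Proof.
by rewrite /weighted_sum mulr_sumr; apply: eq_bigr => i _; rewrite mxE mulrCA.
Qed.

Lemma coord_le_norm x i : `|x ord0 i| <= `|x|.
Proof.
rewrite {2}/Num.norm/= mx_normrE.
exact: (le_bigmax _ (fun ij : 'I_1 * 'I_n => `|x ij.1 ij.2|) (ord0, i)).
Qed.

Lemma weighted_sum_le_norm u x : weighted_sum u x <= (\sum_i `|u i|) * `|x|.
Proof.
rewrite /weighted_sum mulr_suml; apply: ler_sum => i _.
rewrite (le_trans (ler_norm _))// normrM ler_wpM2l//.
exact: coord_le_norm.
Qed.

(** Any linear form [u] is allowed, so that [x_i], [- x_i] and [T_w] are treated alike. *)
Definition halfspace u s : set 'rV[R]_n := [set x | s < weighted_sum u x].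

Lemma halfspace_away u s A : 0 < s -> A `<=` halfspace u s ->
  bounded_away_from0 A.
Proof.
(* The added 1 keeps the divisor positive when [u] vanishes. *)
move=> s0 As; have S0 : 0 < 1 + \sum_i `|u i|.
  by rewrite ltr_pwDl// sumr_ge0.
exists (s / (1 + \sum_i `|u i|)) => [|x /As /= sx]; first by rewrite divr_gt0.
rewrite ler_pdivrMr// (le_trans (ltW sx))//.
rewrite (le_trans (weighted_sum_le_norm u x))// mulrC ler_wpM2l//.
by rewrite lerDr.
Qed.

Lemma measurable_continuous_rV (f : 'rV[R]_n -> R) (D : set (borel_rV R n)) :
  continuous f -> measurable_fun D (f : borel_rV R n -> R).
Proof.
move=> cf; apply: measurable_funTS.
move=> _; apply: (measurability _ (RGenOInfty.measurableE R)) => //.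
move=> /= _ [_ [s ->] <-]; rewrite setTI; apply: sub_sigma_algebra.
by apply: open_comp (@interval_open _ _ _ _ _) => // ? _; exact: cf.
Qed.

Lemma measurable_weighted_sum u (D : set (borel_rV R n)) :
  measurable_fun D (weighted_sum u : borel_rV R n -> R).
Proof. by apply: measurable_continuous_rV; exact: weighted_sum_continuous. Qed.

Lemma measurable_halfspace u s :
  measurable (halfspace u s : set (borel_rV R n)).
Proof.
have -> : halfspace u s = setT `&` weighted_sum u @^-1` `]s, +oo[.
  rewrite setTI; apply/seteqP; split => x;
    by rewrite /halfspace/= in_itv/= andbT.
exact: measurable_weighted_sum.
Qed.

Definition dilation r A : set 'rV[R]_n := [set r *: x | x in A].

Lemma dilationE r A : r != 0 -> dilation r A = [set x | A (r^-1 *: x)].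
Proof.
move=> r0; apply/seteqP; split => [_ [x Ax <-]|x /= Ax] /=.
  by rewrite scalerK.
by exists (r^-1 *: x) => //; rewrite scalerKV.
Qed.

Lemma dilation_dilation r s A : dilation r (dilation s A) = dilation (r * s) A.
Proof.
apply/seteqP; split => [_ [_ [x Ax <-] <-]|_ [x Ax <-]].
  by exists x; rewrite ?scalerA.
by exists (s *: x); [exists x|rewrite scalerA].
Qed.

Lemma dilation_halfspace r u s : 0 < r ->
  dilation r (halfspace u s) = halfspace u (r * s).
Proof.
move=> r0; rewrite dilationE ?gt_eqF//; apply/seteqP; split => x /=;
  by rewrite /halfspace/= weighted_sumZ ltr_pdivlMl.
Qed.

End linear_functional.

(** This set contains the boundary of [halfspace u s]; when it is null, the half-space is a
    continuity set of the measure. *)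
Definition level (R : realType) (n : nat) (u : 'I_n -> R) (s : R)
  : set 'rV[R]_n := [set x | weighted_sum u x = s].

Lemma measurable_level (R : realType) (n : nat) (u : 'I_n -> R) (s : R) :
  measurable (level u s : set (borel_rV R n)).
Proof.
have -> : level u s = setT `&` weighted_sum u @^-1` [set s].
  by rewrite setTI.
exact: measurable_weighted_sum.
Qed.

(** * Tails of a linear form under a measure finite away from the origin *)

Section finite_away_from0.
Context (R : realType) (n : nat) (mu : {measure set (borel_rV R n) -> \bar R}).
Hypothesis mu_away : forall A : set (borel_rV R n), measurable A ->
  bounded_away_from0 A -> (mu A < +oo)%E.
Implicit Types (u : 'I_n -> R) (a b s r : R).

Lemma halfspace_fin_num u s : 0 < s -> mu (halfspace u s) \is a fin_num.
Proof.
move=> s0; rewrite ge0_fin_numE//; apply: mu_away.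
  exact: measurable_halfspace.
exact: (halfspace_away s0 (@subset_refl _ _)).
Qed.

Lemma halfspace_le u s r : r <= s ->
  (mu (halfspace u s) <= mu (halfspace u r))%E.
Proof.
move=> rs; apply: le_measure; rewrite ?inE; try exact: measurable_halfspace.
by move=> x; exact: le_lt_trans.
Qed.

(** The levels between [a] and [b] lie in the half-space above [a / 2], which has finite mass, so
    only countably many of them are charged. *)
Lemma null_level_in u a b : 0 < a -> a < b ->
  exists2 s, a < s < b & mu (level u s) = 0%E.
Proof.
move=> a0 ab.
have Hfin : (mu (halfspace u (a / 2)) < +oo)%E.
  by rewrite -ge0_fin_numE// halfspace_fin_num// divr_gt0.
have [s /andP[a_s sb] sE] := @null_fiber_in_itv _ (borel_rV R n) R mu
  (halfspace u (a / 2)) (weighted_sum u) a b (measurable_halfspace u _) Hfin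
  (@measurable_weighted_sum R n u _) ab.
exists s; first by rewrite a_s.
rewrite -sE; congr (mu _); apply/seteqP; split => x; last by case.
rewrite /level/= => Ls; split => //; rewrite /halfspace/= Ls.
by rewrite (lt_trans _ a_s)// ltr_pdivrMr// ltr_pMr// ltr1n.
Qed.

(* The null levels are dense, so monotonicity alone transfers the power law to
   every threshold. *)
Lemma halfspace_power_law u (K : R) :
  (forall s, 0 < s -> mu (level u s) = 0%E ->
    mu (halfspace u s) = (K / s)%:E) ->
  forall s, 0 < s -> mu (halfspace u s) = (K / s)%:E.
Proof.
move=> Kgood s s0.
have K0 : 0 <= K.
  have [r /andP[r0 _] mr] := null_level_in u s0 (ltr_pwDr ltr01 (lexx s)).
  have r_gt0 : 0 < r by exact: lt_trans r0.
  have : (0 <= mu (halfspace u r))%E by exact: measure_ge0.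
  by rewrite (Kgood _ r_gt0 mr) lee_fin pmulr_lge0 ?invr_gt0.
rewrite -(fineK (halfspace_fin_num u s0)); congr EFin.
apply/eqP; rewrite eq_le; apply/andP; split.
(* If the mass [f] exceeded [K / s], a null level [r < s] with [K / f < r] would give a larger
   half-space the smaller mass [K / r]. The bound [s / 2] keeps [r] positive when [K = 0]. *)
- rewrite ler_pdivlMr// leNgt; apply/negP => Kf.
  have f0 : 0 < fine (mu (halfspace u s)).
    by rewrite -(pmulr_lgt0 _ s0) (le_lt_trans K0).
  set f := fine _ in Kf f0.
  have ms : Num.max (s / 2) (K / f) < s.
    rewrite gt_max ltr_pdivrMr// ltr_pdivrMr//.
    by rewrite ltr_pMr// ltr1n mulrC.
  have m0 : 0 < Num.max (s / 2) (K / f) by rewrite lt_max divr_gt0.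
  have [r /andP[]] := null_level_in u m0 ms.
  rewrite gt_max => /andP[sr Kr] rs mr.
  have r0 : 0 < r by apply: lt_trans sr; rewrite divr_gt0.
  have := halfspace_le u (ltW rs); rewrite (Kgood _ r0 mr).
  rewrite -(fineK (halfspace_fin_num u s0)) lee_fin -/f ler_pdivlMr//.
  by rewrite leNgt mulrC -ltr_pdivrMr// Kr.
- rewrite leNgt; apply/negP; rewrite ltr_pdivlMr// => fK.
  set f := fine _ in fK.
  have f0 : 0 <= f by rewrite fine_ge0.
  (* Symmetrically, a null level [r] in []s, s + e[] has [K / r > f]. The divisor [f + 1] in the
     choice of [e] covers [f = 0]. *)
  have [e e0 ef] : exists2 e, 0 < e & f * (s + e) < K.
    have f1 : 0 < f + 1 by rewrite ltr_wpDl.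
    exists ((K - f * s) / (f + 1)); first by rewrite divr_gt0 ?subr_gt0.
    have -> : f * (s + (K - f * s) / (f + 1)) = (f * K + f * s) / (f + 1).
      by field; rewrite gt_eqF.
    by rewrite ltr_pdivrMr//; lra.
  have [r /andP[sr re] mr] := null_level_in u s0 (ltr_pwDr e0 (lexx s)).
  have r0 := lt_trans s0 sr.
  have := halfspace_le u (ltW sr); rewrite (Kgood _ r0 mr).
  rewrite -(fineK (halfspace_fin_num u s0)) lee_fin -/f ler_pdivrMr//.
  rewrite leNgt => /negP; apply; apply: le_lt_trans ef.
  by rewrite ler_wpM2l// ltW.
Qed.

(* [K / s] is continuous in [s], so the tail has no jump. *)
Lemma null_level u (K : R) :
  (forall s, 0 < s -> mu (halfspace u s) = (K / s)%:E) ->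
  forall s, 0 < s -> mu (level u s) = 0%E.
Proof.
move=> Klaw s s0.
have mlf : mu (level u s) \is a fin_num.
  rewrite ge0_fin_numE//; apply: mu_away; first exact: measurable_level.
  apply: (@halfspace_away _ _ u (s / 2)); first by rewrite divr_gt0.
  move=> x; rewrite /level /halfspace/= => ->.
  by rewrite ltr_pdivrMr// ltr_pMr// ltr1n.
(* For [r < s] the level at [s] and the half-space beyond it are disjoint parts of [halfspace u r];
   given this bound, it remains to choose [r]. *)
suff bnd r : 0 < r -> r < s -> fine (mu (level u s)) + K / s <= K / r.
  rewrite -(fineK mlf); congr EFin; apply/eqP.
  rewrite eq_le fine_ge0// andbT; set f := fine _ in bnd *.
  rewrite leNgt; apply/negP => f0.
  (* For [K <= 0], the choice [r = s / 2] gives [f <= K / s <= 0]. *)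
  have [K0|K0] := leP K 0.
    have s2 : s / 2 < s by rewrite ltr_pdivrMr// ltr_pMr// ltr1n.
    have := bnd (s / 2) (divr_gt0 s0 (ltr0Sn _ _)) s2.
    have -> : K / (s / 2) = K / s * 2 by field; rewrite gt_eqF.
    have : K / s <= 0 by rewrite ler_pdivrMr ?mul0r.
    lra.
  (* The choice [r = K / (f / 2 + K / s)] makes [K / r] exceed [K / s] by only [f / 2], against the
     bound. *)
  have c : 0 < f / 2 + K / s by rewrite addr_gt0// divr_gt0.
  have := bnd (K / (f / 2 + K / s)).
  have -> : K / (K / (f / 2 + K / s)) = f / 2 + K / s.
    by rewrite invf_div mulrCA divff ?gt_eqF// mulr1.
  rewrite divr_gt0// ltr_pdivrMr//.
  have -> : s * (f / 2 + K / s) = K + s * f / 2 by field; rewrite gt_eqF.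
  rewrite ltrDl divr_gt0 ?mulr_gt0//.
  by move=> /(_ isT isT); lra.
move=> r0 rs.
rewrite -lee_fin EFinD (fineK mlf) -(Klaw s)// -(Klaw r)// -measureU//.
- apply: le_measure; rewrite ?inE.
  + apply: (@measurableU _ (borel_rV R n)); first exact: measurable_level.
    exact: measurable_halfspace.
  + exact: measurable_halfspace.
  move=> x [Lx|]; last exact: lt_trans.
  by rewrite /halfspace/= Lx.
- exact: measurable_level.
- exact: measurable_halfspace.
- apply/seteqP; split => x //=; rewrite /level /halfspace/= => -[->].
  by rewrite ltxx.
Qed.

End finite_away_from0.

(** The finite family is padded with empty sets to a sequence. *)
Lemma negligible_bigcup_ord (d : measure_display) (T : sigmaRingType d)
    (R : realFieldType) (mu : {measure set T -> \bar R}) (n : nat)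
    (F : 'I_n -> set T) :
  (forall i, mu.-negligible (F i)) -> mu.-negligible (\bigcup_i F i).
Proof.
move=> F0; pose G k := if insub k is Some i then F i else set0.
apply: (@negligibleS _ _ _ _ (\bigcup_k G k)).
  by move=> x [i _ Fx]; exists (val i) => //; rewrite /G valK.
apply: negligible_bigcup => k; rewrite /G; case: insubP => [i _ _|_] //.
exact: negligible_set0.
Qed.

(** * Coordinate forms, null sets and the orthant *)

Section coordinates.
Context (R : realType) (n : nat).

(** The dual basis, which makes each coordinate an instance of [weighted_sum]. *)
Definition basis_form (i : 'I_n) : 'I_n -> R := fun j => (j == i)%:R.

Lemma basis_formE i x : weighted_sum (basis_form i) x = x ord0 i.
Proof.
rewrite /weighted_sum (bigD1 i)//= big1 ?addr0 /basis_form ?eqxx ?mul1r//.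
by move=> j /negbTE ->; rewrite mul0r.
Qed.

Lemma basis_formNE i x : weighted_sum (\- basis_form i) x = - x ord0 i.
Proof.
rewrite -basis_formE /weighted_sum -sumrN.
by apply: eq_bigr => j _; rewrite mulNr.
Qed.

Lemma measurable_origin : measurable ([set 0] : set (borel_rV R n)).
Proof.
rewrite -[[set 0]]setCK; apply: measurableC; apply: sub_sigma_algebra.
apply: closed_openC; apply: accessible_closed_set1.
exact/hausdorff_accessible/norm_hausdorff.
Qed.

Lemma measurable_closure (A : set 'rV[R]_n) :
  measurable (closure A : set (borel_rV R n)).
Proof.
rewrite -[closure A]setCK; apply: measurableC.
apply: sub_sigma_algebra; apply: closed_openC; exact: closed_closure.
Qed.

Lemma measurable_boundary (A : set 'rV[R]_n) :
  measurable (boundary A : set (borel_rV R n)).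
Proof.
apply: (@measurableD _ (borel_rV R n)); first exact: measurable_closure.
by apply: sub_sigma_algebra; exact: open_interior.
Qed.

Context (mu : {measure set (borel_rV R n) -> \bar R}).

Lemma null_boundary (A N : set 'rV[R]_n) :
  boundary A `<=` N -> mu.-negligible N -> mu (boundary A) = 0%E.
Proof.
move=> AN N0; apply/(negligibleP mu (measurable_boundary A)).
exact: negligibleS N0.
Qed.

Lemma negligible_level u s : mu (level u s) = 0%E -> mu.-negligible (level u s).
Proof. by move=> ?; apply/negligibleP => //; exact: measurable_level. Qed.

Lemma null_boundary_halfspace u s :
  mu (level u s) = 0%E -> mu (boundary (halfspace u s)) = 0%E.
Proof.
move=> /negligible_level; apply: null_boundary.
by apply: boundary_gt; exact: weighted_sum_continuous.
Qed.

(** The open half-space is the union of those at the thresholds [k.+1%:R^-1]. *)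
Lemma negligible_open_halfspace u :
  (forall s, 0 < s -> mu (halfspace u s) = 0%E) ->
  mu.-negligible (halfspace u 0).
Proof.
move=> u0; apply: (@negligibleS _ (borel_rV R n) _ mu
  (\bigcup_k halfspace u k.+1%:R^-1)).
  by move=> x /ltr_add_invr[k]; rewrite add0r => kx; exists k.
apply: negligible_bigcup => k.
apply/(negligibleP mu (measurable_halfspace u _)).
by apply: u0; rewrite invr_gt0.
Qed.

(** The limit measure will be carried by this set, on which [w i * x_i <= T_w] for nonnegative
    weights. *)
Definition orthant : set 'rV[R]_n := [set x | forall i, 0 <= x ord0 i].

Lemma setC_orthant :
  ~` orthant = \bigcup_i halfspace (\- basis_form i) 0.
Proof.
apply/seteqP; split => [x /existsNP[i /negP]|x [i _]].
  by rewrite -ltNge => xi; exists i => //;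
    rewrite /halfspace/= basis_formNE oppr_gt0.
rewrite /halfspace/= basis_formNE oppr_gt0 => xi /(_ i).
by rewrite leNgt xi.
Qed.

Lemma measurable_orthant : measurable (orthant : set (borel_rV R n)).
Proof.
rewrite -[orthant]setCK setC_orthant; apply: measurableC.
apply: fin_bigcup_measurable => // i _; exact: measurable_halfspace.
Qed.

End coordinates.

(** * Homogeneity of the limit measure *)

(* [nu] is the law of the random vector, as a bare set function: neither
   additivity nor measurability of its argument matters. *)
Section scaling_limit.
Context (R : realType) (n : nat).
Context (mu : {measure set (borel_rV R n.+1) -> \bar R}).
Hypothesis mu_away : forall A : set (borel_rV R n.+1), measurable A ->
  bounded_away_from0 A -> (mu A < +oo)%E.
Variables (b : R -> R) (nu : set 'rV[R]_n.+1 -> R).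
Hypothesis nu_lim : forall A : set 'rV[R]_n.+1,
  measurable (A : set (borel_rV R n.+1)) -> bounded_away_from0 A ->
  mu (boundary A) = 0%E ->
  b t * nu (dilation t A) @[t --> +oo] --> fine (mu A).

Lemma nu_halfspace_lim (u : 'I_n.+1 -> R) (s : R) :
  0 < s -> mu (level u s) = 0%E ->
  b t * nu (halfspace u (t * s)) @[t --> +oo] --> fine (mu (halfspace u s)).
Proof.
move=> s0 us.
have := nu_lim (measurable_halfspace u s)
  (halfspace_away s0 (@subset_refl _ _)) (null_boundary_halfspace us).
apply: cvg_trans; apply: near_eq_cvg; near=> t.
by rewrite dilation_halfspace.
Unshelve. all: by end_near. Qed.

Section marginals.
Hypothesis nu_pos : forall i s, 1 <= s ->
  nu (halfspace (basis_form R i) s) = s^-1.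
Hypothesis nu_neg : forall i (s : R), 0 < s ->
  nu (halfspace (\- basis_form R i) s) = 0.
Hypothesis mu0 : mu [set 0] = 0%E.
Hypothesis mu_neq0 :
  exists2 A : set (borel_rV R n.+1), measurable A & mu A != 0%E.

(** Once [t * s >= 1], the marginal tail is [(t * s)^-1], so [b t / t] equals [s] times the quantity
    whose limit regular variation prescribes. *)
Lemma rate_lim i s : 0 < s -> mu (level (basis_form R i) s) = 0%E ->
  b t / t @[t --> +oo] --> s * fine (mu (halfspace (basis_form R i) s)).
Proof.
move=> s0 is0.
have : s * (b t * nu (halfspace (basis_form R i) (t * s))) @[t --> +oo] -->
    s * fine (mu (halfspace (basis_form R i) s)).
  by apply: cvgM; [exact: cvg_cst|exact: nu_halfspace_lim].
apply: cvg_trans; apply: near_eq_cvg; near=> t.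
have t0 : 0 < t by near: t; exact: nbhs_pinfty_gt.
rewrite nu_pos.
  by rewrite invfM; field; rewrite !gt_eqF.
rewrite -ler_pdivrMr//; near: t; apply: nbhs_pinfty_ge; exact: num_real.
Unshelve. all: by end_near. Qed.

(** The mass of [- x_i > r] is a limit of zeros at null levels; the power law with constant 0 covers
    all [r]. *)
Lemma negligible_setC_orthant : mu.-negligible (~` @orthant R n.+1).
Proof.
rewrite setC_orthant; apply: negligible_bigcup_ord => i.
apply: negligible_open_halfspace => s s0.
suff H r : 0 < r -> mu (level (\- basis_form R i) r) = 0%E ->
    mu (halfspace (\- basis_form R i) r) = (0 / r)%:E.
  by rewrite (halfspace_power_law mu_away H)// mul0r.
move=> r0 mr; rewrite mul0r -(fineK (halfspace_fin_num mu_away _ r0)).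
congr EFin.
apply: cvg_unique (nu_halfspace_lim r0 mr) _; first exact: Rhausdorff.
apply: (@cvg_trans _ (0 @[t --> +oo])); last exact: cvg_cst.
apply: near_eq_cvg; near=> t; rewrite nu_neg ?mulr0//.
by rewrite mulr_gt0.
Unshelve. all: by end_near. Qed.

(** The ratio [b t / t] depends neither on [i] nor on [s], so uniqueness of its limit forces one
    constant for all marginals. *)
Lemma marginal_tails : exists2 c : R, 0 < c &
  b t / t @[t --> +oo] --> c /\
  forall i (s : R), 0 < s -> mu (halfspace (basis_form R i) s) = (c / s)%:E.
Proof.
have ltr12 : 1 < 2 :> R by rewrite ltr1n.
have [s0 /andP[s0_gt1 _] ms0] :=
  null_level_in mu_away (basis_form R ord0) ltr01 ltr12.
have s0_gt0 : 0 < s0 by exact: lt_trans s0_gt1.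
pose c := s0 * fine (mu (halfspace (basis_form R ord0) s0)).
have bc : b t / t @[t --> +oo] --> c by exact: rate_lim.
have tails i (s : R) : 0 < s ->
    mu (halfspace (basis_form R i) s) = (c / s)%:E.
  move: s; apply: halfspace_power_law => // s s_gt0 ms.
  rewrite -(fineK (halfspace_fin_num mu_away _ s_gt0)); congr EFin.
  apply: (mulfI (lt0r_neq0 s_gt0)).
  rewrite [RHS]mulrC divfK ?gt_eqF//.
  exact: cvg_unique (@Rhausdorff R) _ _ _ _ (rate_lim s_gt0 ms) bc.
exists c => //; rewrite lt0r mulr_ge0 ?(ltW s0_gt0) ?fine_ge0// andbT.
(* If [c = 0], the origin, the complement of the orthant and the half-spaces [x_i > 0] are all null;
   they cover the space, whereas [mu] is non-zero. *)
apply/eqP => c0; have [A mA] := mu_neq0; rewrite -/c in c0 => /eqP; apply.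
apply/(negligibleP mu mA).
apply: (@negligibleS _ (borel_rV R n.+1) _ mu
  (([set 0] `|` ~` @orthant R n.+1) `|`
   \bigcup_i halfspace (basis_form R i) 0)).
  move=> x _; have [xO|] := pselect (orthant x); last by left; right.
  have [->|x0] := eqVneq x 0; first by left; left.
  right; apply: contrapT => xH; move/negP: x0; apply; apply/eqP/rowP => i.
  rewrite mxE; apply/eqP; rewrite eq_le xO andbT leNgt; apply/negP => xi.
  by apply: xH; exists i => //; rewrite /halfspace/= basis_formE.
apply: negligibleU; first apply: negligibleU.
- by apply/(negligibleP mu (@measurable_origin R n.+1)).
- exact: negligible_setC_orthant.
- apply: negligible_bigcup_ord => i.
  apply: negligible_open_halfspace => s s_gt0.
  by rewrite tails// c0 mul0r.
Qed.
End marginals.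

Variable c : R.
Hypothesis b_gt0 : forall t, 0 < t -> 0 < b t.
Hypothesis c_gt0 : 0 < c.
Hypothesis b_lim : b t / t @[t --> +oo] --> c.

(** Dividing by [b t / t] replaces the unknown rate [b t] by [t]. *)
Lemma tail_lim (A : set 'rV[R]_n.+1) :
  measurable (A : set (borel_rV R n.+1)) -> bounded_away_from0 A ->
  mu (boundary A) = 0%E ->
  t * nu (dilation t A) @[t --> +oo] --> fine (mu A) / c.
Proof.
move=> mA aA bA.
have : (b t * nu (dilation t A)) * (b t / t)^-1 @[t --> +oo]
    --> fine (mu A) / c.
  by apply: cvgM; [exact: nu_lim|apply: cvgV => //; rewrite gt_eqF].
apply: cvg_trans; apply: near_eq_cvg; near=> t.
have t0 : 0 < t by near: t; exact: nbhs_pinfty_gt.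
by rewrite invf_div; field; rewrite gt_eqF// b_gt0.
Unshelve. all: by end_near. Qed.

(** Substituting [t * r] for [t] in the limit for [A] gives the limit for its dilation, up to the
    factor [r^-1]. *)
Lemma measure_dilation (A : set 'rV[R]_n.+1) (r : R) : 0 < r ->
  measurable (A : set (borel_rV R n.+1)) -> bounded_away_from0 A ->
  mu (boundary A) = 0%E ->
  measurable (dilation r A : set (borel_rV R n.+1)) ->
  bounded_away_from0 (dilation r A) ->
  mu (boundary (dilation r A)) = 0%E ->
  fine (mu (dilation r A)) = fine (mu A) / r.
Proof.
move=> r0 mA aA bA mrA arA brA.
apply: (mulIf (_ : c^-1 != 0)); first by rewrite invr_eq0 gt_eqF.
apply: cvg_unique (tail_lim mrA arA brA) _; first exact: Rhausdorff.
have tr : t * r @[t --> +oo] --> +oo.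
  by under eq_fun do rewrite mulrC; apply: gt0_cvgMry => //; exact: cvg_id.
have := cvg_comp _ _ tr (tail_lim mA aA bA) => trA.
have : r^-1 * ((t * r) * nu (dilation (t * r) A)) @[t --> +oo]
    --> r^-1 * (fine (mu A) / c).
  by apply: cvgM; [exact: cvg_cst|exact: trA].
rewrite mulrA [_^-1 * _]mulrC.
apply: cvg_trans; apply: near_eq_cvg; near=> t.
by rewrite dilation_dilation; field; rewrite gt_eqF.
Unshelve. all: by end_near. Qed.

(** Every half-space of [u] is a dilation of the one at a fixed null level [s0]. *)
Lemma halfspace_law u : exists K : R,
  forall s, 0 < s -> mu (halfspace u s) = (K / s)%:E.
Proof.
have ltr12 : 1 < 2 :> R by rewrite ltr1n.
have [s0 /andP[s0_gt1 _] ms0] := null_level_in mu_away u ltr01 ltr12.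
have s0_gt0 : 0 < s0 by exact: lt_trans s0_gt1.
exists (s0 * fine (mu (halfspace u s0))).
apply: halfspace_power_law => // s s_gt0 ms.
rewrite -(fineK (halfspace_fin_num mu_away _ s_gt0)); congr EFin.
have r0 : 0 < s / s0 by rewrite divr_gt0.
have dE : dilation (s / s0) (halfspace u s0) = halfspace u s.
  by rewrite dilation_halfspace// divfK// gt_eqF.
rewrite -{1}dE measure_dilation ?dE//.
- by field; rewrite !gt_eqF.
- exact: measurable_halfspace.
- exact: halfspace_away s0_gt0 (@subset_refl _ _).
- exact: null_boundary_halfspace.
- exact: measurable_halfspace.
- exact: halfspace_away s_gt0 (@subset_refl _ _).
- exact: null_boundary_halfspace.
Qed.

Lemma halfspace_tail_lim u K :
  (forall s, 0 < s -> mu (halfspace u s) = (K / s)%:E) ->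
  t * nu (halfspace u t) @[t --> +oo] --> K / c.
Proof.
move=> Klaw.
have := tail_lim (measurable_halfspace u 1)
  (halfspace_away ltr01 (@subset_refl _ _))
  (null_boundary_halfspace (null_level mu_away Klaw ltr01)).
rewrite (Klaw _ ltr01) divr1.
apply: cvg_trans; apply: near_eq_cvg; near=> t.
by rewrite dilation_halfspace// mulr1.
Unshelve. all: by end_near. Qed.

End scaling_limit.

(** * All weighted sums of the coordinates have the same tail constant *)

Section geometric_partition.
Context (R : realType) (T : Type) (f : T -> R) (l q : R).
Hypotheses (l1 : 1 < l) (q0 : 0 < q).

Let l0 : 0 < l. Proof. exact: lt_trans l1. Qed.

(** Bernoulli's inequality [1 + k (l - 1) <= l ^ k] reduces this to the Archimedean property. *)
Lemma expr_unbounded (y : R) : exists k, y < l ^+ k.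
Proof.
have [k yk] : exists k : nat, y < k%:R * (l - 1).
  exists (Num.trunc (y / (l - 1))).+1.
  by rewrite -ltr_pdivrMr ?subr_gt0// truncnS_gt.
exists k; apply: lt_le_trans yk _.
suff : 1 + k%:R * (l - 1) <= l ^+ k by apply: le_trans; rewrite lerDr.
elim: k => [|k ih]; first by rewrite mul0r addr0.
rewrite exprS; apply: le_trans (ler_wpM2l (ltW l0) ih).
rewrite -natr1; have : 0 <= k%:R * (l - 1) * (l - 1).
  by rewrite !mulr_ge0// subr_ge0 ltW.
lra.
Qed.

Lemma geometric_bigcup :
  \bigcup_k [set x | q * l ^+ k < f x <= q * l ^+ k.+1] = [set x | q < f x].
Proof.
apply/seteqP; split => [x [k _ /= /andP[kx _]]|x /= qx].
  by apply: le_lt_trans kx; rewrite ler_pMr// exprn_ege1// ltW.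
have : exists k, f x <= q * l ^+ k.+1.
  have [k fk] := expr_unbounded (f x / q); exists k.
  rewrite -ler_pdivrMl// mulrC (le_trans (ltW fk))//.
  by rewrite ler_eXn2l.
case/ex_minnP => k xk kmin; exists k => //=; rewrite xk andbT.
case: k xk kmin => [|k] xk kmin; first by rewrite mulr1.
by rewrite ltNge; apply/negP => /kmin; rewrite ltnn.
Qed.

(** The cells descend to 0: the upper end of cell [k + 1] is the lower end of cell [k], and cell 0
    ends at [l / q]. *)
Lemma geometric_bigcupV :
  \bigcup_k [set x | (q * l ^+ k)^-1 < f x <= l * (q * l ^+ k)^-1] =
  [set x | 0 < f x <= l / q].
Proof.
have q_gt0 k : 0 < q * l ^+ k by rewrite mulr_gt0// exprn_gt0.
apply/seteqP; split => [x [k _ /= /andP[kx xk]]|x /= /andP[fx0 fxq]].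
  rewrite (lt_trans _ kx) ?invr_gt0// (le_trans xk)// ler_pM2l//.
  by rewrite lef_pV2 ?posrE// ler_pMr// exprn_ege1// ltW.
have : exists k, (q * l ^+ k)^-1 < f x.
  have [k fk] := expr_unbounded (f x * q)^-1; exists k.
  rewrite -[ltRHS]invrK ltf_pV2 ?posrE ?invr_gt0//.
  by move: fk; rewrite invfM mulrC ltr_pdivrMl.
case/ex_minnP => k xk kmin; exists k => //=; rewrite xk.
case: k xk kmin => [|k] xk kmin; first by rewrite mulr1.
rewrite leNgt; apply/negP => lx; suff /kmin : (q * l ^+ k)^-1 < f x.
  by rewrite ltnn.
by move: lx; rewrite exprS mulrCA invfM mulrA divff ?gt_eqF// mul1r.
Qed.

Lemma geometric_trivIset :
  trivIset setT (fun k => [set x | q * l ^+ k < f x <= q * l ^+ k.+1]).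
Proof.
apply: ltn_trivIset => j i ij.
apply/seteqP; split => x //= [/andP[_ xi] /andP[jx _]].
have := lt_le_trans jx xi; rewrite ltr_pM2l// ltr_eXn2l// ltnS.
by rewrite leqNgt ij.
Qed.

Lemma geometric_trivIsetV :
  trivIset setT
    (fun k => [set x | (q * l ^+ k)^-1 < f x <= l * (q * l ^+ k)^-1]).
Proof.
have q_gt0 k : 0 < q * l ^+ k by rewrite mulr_gt0// exprn_gt0.
apply: ltn_trivIset => j i ij.
apply/seteqP; split => x //= [/andP[ix _] /andP[_ xj]].
have := lt_le_trans ix xj; case: j ij {xj} => // j ij.
rewrite exprS mulrCA [(l * _)^-1]invfM mulrA divff ?gt_eqF// mul1r.
by rewrite ltf_pV2 ?posrE// ltr_pM2l// ltr_eXn2l// ltnNge -ltnS ij.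
Qed.

End geometric_partition.

(** * Slabs between two levels of a linear form *)

Section slab.
Context (R : realType) (n : nat).
Implicit Types (u : 'I_n -> R) (a b r s : R).

(** Half-open, so that consecutive slabs partition. *)
Definition slab u a b : set 'rV[R]_n := [set x | a < weighted_sum u x <= b].

Lemma slabE u a b :
  slab u a b = halfspace u a `&` [set x | weighted_sum u x <= b].
Proof. by apply/seteqP; split => x /= /andP. Qed.

Lemma slab_halfspaceD u a b : slab u a b = halfspace u a `\` halfspace u b.
Proof.
apply/seteqP; split => x; rewrite /slab /halfspace/=.
  by move=> /andP[-> xb]; split => //; apply/negP; rewrite -leNgt.
by case=> -> /negP; rewrite -leNgt.
Qed.

Lemma measurable_slab u a b : measurable (slab u a b : set (borel_rV R n)).
Proof.
rewrite slab_halfspaceD; apply: (@measurableD _ (borel_rV R n));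
  exact: measurable_halfspace.
Qed.

Lemma dilation_slab u a b r : 0 < r ->
  dilation r (slab u a b) = slab u (r * a) (r * b).
Proof.
move=> r0; rewrite dilationE ?gt_eqF//; apply/seteqP; split => x /=;
  by rewrite /slab/= weighted_sumZ ltr_pdivlMl// ler_pdivrMl.
Qed.

Lemma dilationI (A B : set 'rV[R]_n) r : r != 0 ->
  dilation r (A `&` B) = dilation r A `&` dilation r B.
Proof. by move=> r0; rewrite !dilationE. Qed.

Context (mu : {measure set (borel_rV R n) -> \bar R}).
Hypothesis mu_away : forall A : set (borel_rV R n), measurable A ->
  bounded_away_from0 A -> (mu A < +oo)%E.

Lemma measure_slab u (K : R) a b :
  (forall s, 0 < s -> mu (halfspace u s) = (K / s)%:E) ->
  0 < a -> a <= b -> mu (slab u a b) = (K / a - K / b)%:E.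
Proof.
move=> Klaw a0 ab; have b0 := lt_le_trans a0 ab.
have -> : (K / a - K / b)%:E =
    (mu (halfspace u a) - mu (halfspace u a `&` halfspace u b))%E.
  rewrite setIidr; first by rewrite !Klaw.
  by move=> x; exact: le_lt_trans.
rewrite slab_halfspaceD; apply: measureD; try exact: measurable_halfspace.
by rewrite -ge0_fin_numE// halfspace_fin_num.
Qed.

Lemma null_boundary_slabI u v a b a' b' :
  (forall s, 0 < s -> mu (level u s) = 0%E) ->
  (forall s, 0 < s -> mu (level v s) = 0%E) ->
  0 < a -> 0 < b -> 0 < a' -> 0 < b' ->
  mu (boundary (slab u a b `&` slab v a' b')) = 0%E.
Proof.
move=> u0 v0 *; apply: (@null_boundary _ _ _ _
  ((level u a `|` level u b) `|` (level v a' `|` level v b'))).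
  have bs w c d : boundary (slab w c d) `<=` level w c `|` level w d.
    rewrite slabE; apply: subset_trans (@boundaryI _ _ _) _; apply: setUSS.
      by apply: boundary_gt; exact: weighted_sum_continuous.
    by apply: boundary_le; exact: weighted_sum_continuous.
  by apply: subset_trans (@boundaryI _ _ _) _; apply: setUSS; exact: bs.
by apply: negligibleU; apply: negligibleU; apply: negligible_level; auto.
Qed.

End slab.

(** * Comparison of the tail constants by integration over a slab *)

Section balance.
Context (R : realType) (n : nat) (mu : {measure set (borel_rV R n) -> \bar R}).
Hypothesis mu_away : forall A : set (borel_rV R n), measurable A ->
  bounded_away_from0 A -> (mu A < +oo)%E.
Hypothesis mu_dilation : forall (A : set 'rV[R]_n) (r : R), 0 < r ->
  measurable (A : set (borel_rV R n)) -> bounded_away_from0 A ->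
  mu (boundary A) = 0%E ->
  measurable (dilation r A : set (borel_rV R n)) ->
  bounded_away_from0 (dilation r A) ->
  mu (boundary (dilation r A)) = 0%E ->
  fine (mu (dilation r A)) = fine (mu A) / r.
Hypothesis mu_orthant : mu.-negligible (~` @orthant R n).
Variables (w : 'I_n -> R) (c K : R).
Hypotheses (w_ge0 : forall i, 0 <= w i) (w_sum1 : \sum_i w i = 1).
Hypothesis c_law :
  forall i s, 0 < s -> mu (halfspace (basis_form R i) s) = (c / s)%:E.
Hypothesis K_law : forall s, 0 < s -> mu (halfspace w s) = (K / s)%:E.

(** The cut by the orthant can thus be inserted where signs matter and dropped where homogeneity is
    applied. *)
Lemma measure_orthantI (A : set 'rV[R]_n) :
  measurable (A : set (borel_rV R n)) -> mu (A `&` @orthant R n) = mu A.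
Proof.
move=> mA; have mO := @measurable_orthant R n.
have AE : A = (A `&` @orthant R n) `|` (A `\` @orthant R n) by rewrite setUIDK.
rewrite [RHS](_ : _ = mu ((A `&` @orthant R n) `|` (A `\` @orthant R n)));
  last by rewrite -AE.
have AN : mu (A `\` @orthant R n) = 0%E.
  apply/(negligibleP mu (measurableD mA mO)).
  by apply: negligibleS mu_orthant => x [].
rewrite measureU//; first by rewrite [X in (_ + X)%E]AN adde0.
- exact: (@measurableI _ (borel_rV R n)).
- exact: (@measurableD _ (borel_rV R n)).
- by rewrite -subset0 => x [[_ xO] [_ /(_ xO)]].
Qed.

(** The power laws make every bounding level null, so homogeneity applies to these intersections. *)
Lemma measure_slabI_dilation i a b a' b' r : 0 < r ->
  0 < a -> 0 < b -> 0 < a' -> 0 < b' ->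
  mu (slab (basis_form R i) (r * a) (r * b) `&` slab w (r * a') (r * b')) =
  (r^-1%:E * mu (slab (basis_form R i) a b `&` slab w a' b'))%E.
Proof.
move=> r0 a0 b0 a'0 b'0.
have away p q p' q' : 0 < p -> bounded_away_from0
    (slab (basis_form R i) p q `&` slab w p' q').
  by move=> p0; apply: (halfspace_away p0) => x [/andP[px _] _]; exact: px.
have meas p q p' q' : measurable
    (slab (basis_form R i) p q `&` slab w p' q' : set (borel_rV R n)).
  by apply: (@measurableI _ (borel_rV R n)); exact: measurable_slab.
have fin p q p' q' : 0 < p ->
    mu (slab (basis_form R i) p q `&` slab w p' q') \is a fin_num.
  move=> p0; rewrite ge0_fin_numE//.
  by apply: mu_away; [exact: meas|exact: away].
have bnd p q p' q' : 0 < p -> 0 < q -> 0 < p' -> 0 < q' ->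
    mu (boundary (slab (basis_form R i) p q `&` slab w p' q')) = 0%E.
  by move=> *; apply: null_boundary_slabI => //;
    [exact: null_level (c_law i)|exact: null_level K_law].
have dE : dilation r (slab (basis_form R i) a b `&` slab w a' b') =
    slab (basis_form R i) (r * a) (r * b) `&` slab w (r * a') (r * b').
  by rewrite dilationI ?gt_eqF// !dilation_slab.
rewrite -(fineK (fin _ _ _ _ a0)) -EFinM.
rewrite -(@fineK _ (mu (slab _ (r * a) _ `&` _))) ?fin ?mulr_gt0//.
rewrite -dE mu_dilation ?dE//; last by apply: bnd; rewrite ?mulr_gt0.
- by rewrite mulrC.
- exact: away.
- exact: bnd.
- by apply: away; rewrite mulr_gt0.
Qed.

Section fixed_ratio.
Variable l : R.
Hypothesis l1 : 1 < l.

Let l0 : 0 < l. Proof. exact: lt_trans l1. Qed.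

Let D : set 'rV[R]_n := slab w 1 l `&` @orthant R n.

Let mD : measurable (D : set (borel_rV R n)).
Proof.
apply: (@measurableI _ (borel_rV R n)); first exact: measurable_slab.
exact: measurable_orthant.
Qed.

Let coord i (x : borel_rV R n) : \bar R := ((x : 'rV[R]_n) ord0 i)%:E.

Let measurable_coord i E : measurable_fun E (coord i).
Proof.
apply/measurable_EFinP.
by apply: measurable_continuous_rV; exact: coord_continuous.
Qed.

Let weight_coord_le i x : orthant x -> w i * x ord0 i <= weighted_sum w x.
Proof.
move=> xO; rewrite /weighted_sum (bigD1 i)//= lerDl.
by apply: sumr_ge0 => j _; rewrite mulr_ge0.
Qed.

Section coordinate.
Variable i : 'I_n.
Hypothesis wi0 : 0 < w i.

(** Lower ends of the cells of [x_i]. The cells cover [0 < x_i <= l / w i], hence all positive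
    values on [D], where [w i * x_i <= T_w <= l]. *)
Let s k := (w i * l ^+ k)^-1.
Let s_gt0 k : 0 < s k. Proof. by rewrite invr_gt0 mulr_gt0// exprn_gt0. Qed.
(* By homogeneity [s k * mu (F k)] is the mass of the slab [1 < x_i <= l] cut by
   [w i * l ^+ k < T <= w i * l ^+ k.+1]. On the orthant these cuts fill the
   slab, since [T >= w i * x_i > w i] there. *)
Let F k := slab (basis_form R i) (s k) (l * s k) `&` D.

Let mF k : measurable (F k : set (borel_rV R n)).
Proof.
by apply: (@measurableI _ (borel_rV R n)) => //; exact: measurable_slab.
Qed.

Let measure_F k : ((s k)%:E * mu (F k) =
  mu (slab (basis_form R i) 1 l `&`
      slab w (w i * l ^+ k) (w i * l ^+ k.+1)))%E.
Proof.
rewrite /F /D setIA measure_orthantI; last first.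
  by apply: (@measurableI _ (borel_rV R n)); exact: measurable_slab.
(* Both slabs are written as dilations by [s k]; the factor [(s k)^-1] from homogeneity then cancels
   [s k]. *)
have -> : slab (basis_form R i) (s k) (l * s k) `&` slab w 1 l =
  slab (basis_form R i) (s k * 1) (s k * l) `&`
  slab w (s k * (s k)^-1) (s k * (l / s k)).
  by rewrite mulr1 [s k * l]mulrC mulfV ?gt_eqF// mulrCA mulfV ?gt_eqF// mulr1.
have q0 : 0 < w i * l ^+ k by rewrite mulr_gt0// exprn_gt0.
rewrite measure_slabI_dilation ?divr_gt0 ?invr_gt0//.
rewrite muleA -EFinM mulfV ?gt_eqF// mul1e.
by rewrite /s !invrK exprS [l * (_ * _)]mulrCA.
Qed.

Let sum_measure_F :
  (\sum_(k <oo) (s k)%:E * mu (F k) = (c * (1 - l^-1))%:E)%E.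
Proof.
under eq_eseriesr => k _ do rewrite measure_F.
have <- : mu (slab (basis_form R i) 1 l) = (c * (1 - l^-1))%:E.
  by rewrite (measure_slab mu_away (c_law i) ltr01 (ltW l1)) divr1 mulrBr mulr1.
pose E k := slab (basis_form R i) 1 l `&`
      slab w (w i * l ^+ k) (w i * l ^+ k.+1).
have mE k : measurable (E k : set (borel_rV R n)).
  by apply: (@measurableI _ (borel_rV R n)); exact: measurable_slab.
have UE : \bigcup_k E k = slab (basis_form R i) 1 l `&` halfspace w (w i).
  by rewrite -setI_bigcupr geometric_bigcup.
rewrite -(measure_orthantI (measurable_slab _ _ _)).
have -> : slab (basis_form R i) 1 l `&` @orthant R n =
    (slab (basis_form R i) 1 l `&` halfspace w (w i)) `&` @orthant R n.
  apply/seteqP; split => x [xs xO]; last by split => //; case: xs.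
  split => //; split => //; rewrite /halfspace/=.
  apply: lt_le_trans (weight_coord_le i xO).
  by move: xs => /andP[]; rewrite basis_formE ltr_pMr.
rewrite measure_orthantI; last first.
  by apply: (@measurableI _ (borel_rV R n));
    [exact: measurable_slab|exact: measurable_halfspace].
rewrite -UE measure_bigcup//.
  by apply: eq_eseriesl => k; rewrite in_setT.
by apply: trivIset_setIl; exact: geometric_trivIset.
Qed.

Let bigcup_F : \bigcup_k F k = D `&` [set x | 0 < x ord0 i].
Proof.
rewrite /F -setI_bigcupl setIC.
rewrite (geometric_bigcupV (weighted_sum (basis_form R i)) l1 wi0).
apply/seteqP; split => x [xD /=]; rewrite ?basis_formE.
  by case/andP.
move=> xi; split => //=; rewrite ?basis_formE xi/=.
case: xD => /andP[_ xl] xO.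
by rewrite ler_pdivlMr// mulrC (le_trans (weight_coord_le i xO)).
Qed.

Let trivIset_F : trivIset setT F.
Proof. by apply: trivIset_setIr; exact: geometric_trivIsetV. Qed.

Let coord_ge0 x : D x -> (0 <= coord i x)%E.
Proof. by case=> _ xO; rewrite lee_fin. Qed.

(** Points of [D] with [x_i = 0] lie in no cell but contribute nothing. *)
Let integral_coordE :
  (\int[mu]_(x in D) coord i x = \sum_(k <oo) \int[mu]_(x in F k) coord i x)%E.
Proof.
rewrite -ge0_integral_bigcup//; last by rewrite bigcup_F => x [/coord_ge0].
rewrite bigcup_F [RHS]integral_mkcondr; apply: eq_integral => x /set_mem xD.
rewrite patchE; case: ifPn => // /negP xi; congr EFin; apply/eqP.
rewrite eq_le; apply/andP; split; last by case: xD.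
by rewrite leNgt; apply/negP => xi0; apply: xi; rewrite inE.
Qed.

(** On [F k] the coordinate lies between [s k] and [l * s k]; the bounds are then summed over
    [k]. *)
Lemma integral_coord_bounds :
  ((c * (1 - l^-1))%:E <= \int[mu]_(x in D) coord i x <=
   (l * (c * (1 - l^-1)))%:E)%E.
Proof.
have F_D k : F k `<=` D by move=> x [].
rewrite integral_coordE [(l * _)%:E]EFinM -sum_measure_F.
rewrite -nneseriesZl//; last first.
  by move=> k _; rewrite mule_ge0// lee_fin ltW.
apply/andP; split; apply: lee_nneseries => k _.
- by rewrite mule_ge0// lee_fin ltW.
- rewrite -integral_cst//; apply: ge0_le_integral => //.
  + by move=> x _; rewrite lee_fin ltW.
  + by move=> x [/andP[]]; rewrite basis_formE => sx _ _; rewrite lee_fin ltW.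
- by move=> _; apply: integral_ge0 => x /F_D /coord_ge0.
- rewrite muleA -EFinM -integral_cst//; apply: ge0_le_integral => //.
  + by move=> x /F_D /coord_ge0.
  + by move=> x [/andP[]]; rewrite basis_formE => _ sx _; rewrite lee_fin.
Qed.

End coordinate.

Lemma balance_bounds : c <= l * K /\ K <= l * c.
Proof.
have l1V : 0 < 1 - l^-1 by rewrite subr_gt0 invf_lt1.
have D_meas : mu D = (K * (1 - l^-1))%:E.
  rewrite measure_orthantI; last exact: measurable_slab.
  by rewrite (measure_slab mu_away K_law ltr01 (ltW l1)) divr1 mulrBr mulr1.
have coord_ge0 i x : D x -> (0 <= coord i x)%E.
  by case=> _ xO; rewrite lee_fin.
pose J := (\int[mu]_(x in D) (weighted_sum w x)%:E)%E.
have JE : J = (\sum_i (w i)%:E * \int[mu]_(x in D) coord i x)%E.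
  transitivity (\sum_i \int[mu]_(x in D) ((w i)%:E * coord i x))%E.
    rewrite -ge0_integral_sum//.
    - by apply: eq_integral => x _; rewrite sumEFin.
    - by move=> i; exact: measurable_funeM.
    - by move=> i x xD; apply: mule_ge0; [rewrite lee_fin|exact: coord_ge0].
  apply: eq_bigr => i _; rewrite ge0_integralZl ?lee_fin//; exact: coord_ge0.
have J_lower : ((c * (1 - l^-1))%:E <= J)%E.
  rewrite JE -[X in (X%:E <= _)%E]mul1r -{1}w_sum1 mulr_suml -sumEFin.
  apply: lee_sum => i _; have := w_ge0 i.
  (* A zero weight contributes 0 to both sides; the bounds on the integral of [x_i] are available
     for positive weights. *)
  rewrite le_eqVlt => /predU1P[<-|wi]; first by rewrite mul0r mul0e lexx.
  by rewrite EFinM lee_pmul2l//; case/andP: (integral_coord_bounds wi).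
have J_upper : (J <= (l * (c * (1 - l^-1)))%:E)%E.
  rewrite JE -[X in (_ <= X%:E)%E]mul1r -{1}w_sum1 mulr_suml -sumEFin.
  apply: lee_sum => i _; have := w_ge0 i.
  rewrite le_eqVlt => /predU1P[<-|wi]; first by rewrite mul0r mul0e lexx.
  by rewrite EFinM lee_pmul2l//; case/andP: (integral_coord_bounds wi).
have mw : measurable_fun (D : set (borel_rV R n))
    (fun x : borel_rV R n => (weighted_sum w x)%:E).
  by apply/measurable_EFinP; exact: measurable_weighted_sum.
have D_lower : (mu D <= J)%E.
  rewrite -[leLHS]mul1e -integral_cst//; apply: ge0_le_integral => //.
  by move=> x [/andP[x1 _] _]; rewrite lee_fin ltW.
have D_upper : (J <= l%:E * mu D)%E.
  rewrite -integral_cst//; apply: ge0_le_integral => //.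
    by move=> x [/andP[x1 _] _]; rewrite lee_fin ltW// (lt_trans _ x1).
  by move=> x [/andP[_ xl] _]; rewrite lee_fin.
move: D_lower D_upper; rewrite D_meas => D_lower D_upper.
have := le_trans J_lower D_upper; have := le_trans D_lower J_upper.
rewrite -EFinM !lee_fin !mulrA !ler_pM2r//.
Qed.

End fixed_ratio.

Lemma balance : K = c.
Proof.
have K0 : 0 <= K by rewrite -lee_fin -[K]divr1 -K_law.
have [lK lc] : c <= K /\ K <= c.
  suff H (x y : R) : 0 <= y -> (forall l, 1 < l -> x <= l * y) -> x <= y.
    split; (apply: H => //; last by move=> l l1; case: (balance_bounds l1)).
    (* Nonnegativity of [c] comes from [0 <= K <= 2 * c]. *)
    have ltr12 : 1 < 2 :> R by rewrite ltr1n.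
    have [_ /(le_trans K0)] := balance_bounds ltr12.
    by rewrite pmulr_rge0.
  move=> y0 H; apply/ler_addgt0Pr => e e0.
  have y1 : 0 < y + 1 by rewrite ltr_wpDl.
  (* This ratio [l] gives [l * y <= y + e], also when [y = 0]. *)
  have ey : 1 < 1 + e / (y + 1) by rewrite ltrDl divr_gt0.
  have /le_trans -> // := H _ ey.
  rewrite mulrDl mul1r lerD2l mulrAC ler_pdivrMr// ler_wpM2l ?(ltW e0)//.
  by rewrite lerDl.
by apply/eqP; rewrite eq_le lK lc.
Qed.

End balance.

(** * The Pareto quantile transform *)

Section pareto.
Context (R : realType).
Implicit Types (p u s x : R).

Lemma pareto1_cdf_lt1 x : pareto1_cdf x < 1.
Proof.
rewrite /pareto1_cdf; case: ifPn => // x1.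
by rewrite gtrBl invr_gt0 (lt_le_trans ltr01).
Qed.

Lemma pareto1_cdf_ge0 x : 0 <= pareto1_cdf x.
Proof.
rewrite /pareto1_cdf; case: ifPn => // x1.
by rewrite subr_ge0 invf_le1// (lt_le_trans ltr01).
Qed.

(** The set is the whole line here, and empty for [p >= 1]; in both cases [inf] takes its default
    value 0. *)
Lemma pareto1_quantile_le0 p : p <= 0 -> quantile (@pareto1_cdf R) p = 0.
Proof.
move=> p0; rewrite /quantile inf_out// => -[_ [m mlb]].
have /mlb : p <= pareto1_cdf (m - 1) by exact: le_trans (pareto1_cdf_ge0 _).
by rewrite lerBrDr gerDl ler10.
Qed.

Lemma pareto1_quantile_ge1 p : 1 <= p -> quantile (@pareto1_cdf R) p = 0.
Proof.
move=> p1; rewrite /quantile (_ : [set x | _] = set0) ?inf0//.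
rewrite -subset0 => x /= /(le_trans p1).
by rewrite leNgt pareto1_cdf_lt1.
Qed.

Lemma pareto1_quantile u : 0 < u < 1 ->
  quantile (@pareto1_cdf R) (1 - u) = u^-1.
Proof.
move=> /andP[u0 u1]; rewrite /quantile.
have -> : [set x | 1 - u <= pareto1_cdf x] = `[u^-1, +oo[%classic.
  apply/seteqP; split => x /=; rewrite in_itv/= andbT /pareto1_cdf.
    case: ifPn => [x1|_]; last by rewrite leNgt subr_gt0 u1.
    have x0 := lt_le_trans ltr01 x1.
    by rewrite lerD2l lerN2 -[leRHS]invrK lef_pV2 ?posrE// invr_gt0.
  move=> ux; have x1 : 1 <= x by rewrite (le_trans _ ux)// invf_ge1// ltW.
  have x0 := lt_le_trans ltr01 x1.
  by rewrite x1 lerD2l lerN2 -[leRHS]invrK lef_pV2 ?posrE// invr_gt0.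
by rewrite inf_itv.
Qed.

Lemma pareto1_quantile_ge0 u : 0 <= quantile (@pareto1_cdf R) (1 - u).
Proof.
have [u0|u0] := leP u 0; first by rewrite pareto1_quantile_ge1// lerBrDl gerDr.
have [u1|u1] := leP 1 u; first by rewrite pareto1_quantile_le0// subr_le0.
by rewrite pareto1_quantile ?u0// invr_ge0 ltW.
Qed.

(** Outside []0, 1[] the default 0 stays below [s], so the equivalence holds for every [u] and no
    exceptional event has to be removed. *)
Lemma pareto1_quantile_gt s u : 1 <= s ->
  (s < quantile (@pareto1_cdf R) (1 - u)) = (0 < u < s^-1).
Proof.
move=> s1; have s0 := lt_le_trans ltr01 s1.
have [u0|u0] := leP u 0.
  by rewrite pareto1_quantile_ge1 ?lerBrDl ?gerDr// ltNge ltW.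
have [u1|u1] := leP 1 u.
  rewrite pareto1_quantile_le0 ?subr_le0// ltNge ltW//=.
  by apply/esym/negbTE; rewrite -leNgt (le_trans _ u1)// invf_le1.
by rewrite pareto1_quantile ?u0//= -[s in LHS]invrK ltf_pV2 ?posrE ?invr_gt0.
Qed.

Lemma uniform01_itv s : 1 <= s ->
  uniform_prob (@ltr01 R) `]0, s^-1[%classic = s^-1%:E.
Proof.
move=> s1; have s0 := lt_le_trans ltr01 s1.
rewrite /uniform_prob; transitivity
  (\int[lebesgue_measure]_(x in `]0%R, (s^-1)%R[%classic) (cst 1 x))%E.
  apply: eq_integral => x /set_mem/=; rewrite in_itv/= => /andP[x0 xs].
  rewrite /uniform_pdf (ltW x0) (ltW (lt_le_trans xs _)) ?invf_le1//=.
  by rewrite subr0 invr1.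
rewrite integral_cst//= mul1e lebesgue_measure_itv/= lte_fin invr_gt0 s0.
by rewrite -EFinB subr0.
Qed.

End pareto.

(* The weights sum to 1, so the dimension is positive: it is written d.+1. *)
Theorem corollary1 (R : realType) (d : nat) (w : 'I_d.+1 -> R)
    (w_ge0 : forall i, 0 <= w i)
    (w_sum1 : \sum_(i < d.+1) w i = 1) :
  universally_calibrated (@pareto1_cdf R) (weighted_sum w).
Proof.
move=> disp Omega Pr P Punif X [b [mu [[b_gt0 _] mu0 mu_neq0 mu_away Xlim]]].
pose nu (A : set 'rV[R]_d.+1) := fine (Pr (X @^-1` A)).
have XE i omega : X omega ord0 i = quantile (@pareto1_cdf R) (1 - P i omega).
  by rewrite mxE.
have nu_lim (A : set 'rV[R]_d.+1) : measurable (A : set (borel_rV R d.+1)) ->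
    bounded_away_from0 A -> mu (boundary A) = 0%E ->
    b t * nu (dilation t A) @[t --> +oo] --> fine (mu A).
  move=> mA aA bA; have finA : mu A \is a fin_num.
    by rewrite ge0_fin_numE//; exact: mu_away.
  have := Xlim A mA aA bA; rewrite -[X in _ --> X](fineK finA) => /fine_cvg.
  apply: cvg_trans; apply: near_eq_cvg; near=> t.
  have bt : 0 < b t by apply: b_gt0; near: t; exact: nbhs_pinfty_gt.
  rewrite /nu /=; case: (Pr _) => [r| |] //=.
    by rewrite gt0_muley ?lte_fin// mulr0.
  by rewrite gt0_muleNy ?lte_fin// mulr0.
have nu_pos i (s : R) : 1 <= s -> nu (halfspace (basis_form R i) s) = s^-1.
  move=> s1; rewrite /nu.
  have -> : X @^-1` halfspace (basis_form R i) s = P i @^-1` `]0, s^-1[%classic.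
    apply/seteqP; split => omega;
      by rewrite /halfspace/= basis_formE XE pareto1_quantile_gt// in_itv.
  have := Punif i `]0, s^-1[%classic (measurable_itv _).
  by rewrite /distribution/= /pushforward uniform01_itv// => ->.
have nu_neg i (s : R) : 0 < s -> nu (halfspace (\- basis_form R i) s) = 0.
  move=> s0; rewrite /nu (_ : _ @^-1` _ = set0) ?measure0//.
  rewrite -subset0 => omega; rewrite /halfspace/= basis_formNE XE ltNge.
  by rewrite (le_trans _ (ltW s0))// oppr_le0 pareto1_quantile_ge0.
have [c c_gt0 [b_lim c_law]] :=
  marginal_tails mu_away nu_lim nu_pos nu_neg mu0 mu_neq0.
have [K K_law] := halfspace_law mu_away nu_lim b_gt0 c_gt0 b_lim w.
have KE : K = c.
  apply: (@balance _ _ mu mu_away _ _ w) => //.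
    exact (measure_dilation nu_lim b_gt0 c_gt0 b_lim).
  exact (negligible_setC_orthant mu_away nu_lim nu_neg).
have := halfspace_tail_lim mu_away nu_lim b_gt0 c_gt0 b_lim K_law.
rewrite KE divff ?gt_eqF//.
apply: cvg_trans; apply: near_eq_cvg; near=> t.
have t1 : 1 <= t by near: t; apply: nbhs_pinfty_ge; exact: num_real.
(* For [t >= 1] the denominator is [t^-1], so the ratio is [t] times the tail of [T_w]. *)
have -> : [set omega | t < X omega ord0 ord0] =
    X @^-1` halfspace (basis_form R ord0) t.
  by apply/seteqP; split => omega; rewrite /halfspace/= basis_formE.
by rewrite -/(nu _) nu_pos// invrK mulrC.
Unshelve. all: by end_near. Qed.
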